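(* Let $T\ge K\ge2$, $0<V\le T/K$, and let $W_1,\dots,W_N$ be positive integers with $\sum_j W_j=T$. Set $c=\frac18-\frac{\sqrt{\log(4/3)}}8$. Then for every policy $\pi$: (i) if $W_i\le K^{1/3}(T/V)^{2/3}$ for all $i\in[N]$, then $R^\pi(T;W,V)\ge \frac{c}{3}(KV)^{1/3}T^{2/3}$; (ii) if $W_i\ge K^{1/3}(T/V)^{2/3}$ for all $i\in[N]$, then $R^\pi(T;W,V)\ge c\sum_{i=1}^N\sqrt{KW_i}$.
   Context: Bandit model: arms $[K]=\{1,\dots,K\}$, horizon $T$; in period $t$ arm $k$ has a random reward $Y_{t,k}\in[0,1]$ with mean $\mu_{t,k}\in[0,1]$, independent across periods. A policy $\pi$ chooses $A_t\in[K]$, possibly with internal randomization, as a function only of $A_1,Y_{1,A_1},\dots,A_{t-1},Y_{t-1,A_{t-1}}$, and then observes $Y_{t,A_t}$. $\log$ is the natural logarithm. Window $j$ is $\mathcal W_j=\{\sum_{i<j}W_i+1,\dots,\sum_{i\le j}W_i\}$ and $\mu^*_{\mathcal W_j}=\frac1{W_j}\max_{k}\sum_{t\in\mathcal W_j}\mu_{t,k}$. Regret: $R^\pi(T;W,\{\mu_{t,k}\})=\sum_{j=1}^N W_j\mu^*_{\mathcal W_j}-\mathbb E[\sum_{t=1}^T\mu_{t,A_t}]$, and $R^\pi(T;W,V)=\sup R^\pi(T;W,\{\mu_{t,k}\})$ over all mean sequences $\{\mu_{t,k}\}\in[0,1]^{T\times K}$ with $\sum_{t=1}^{T-1}\max_k|\mu_{t,k}-\mu_{t+1,k}|\le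 V$ and all reward distributions on $[0,1]$ with those means (in particular Bernoulli rewards are allowed). *)

(* Defs.v *)
From HB Require Import structures.
From mathcomp Require Import all_boot all_order all_algebra.
From mathcomp Require Import all_classical all_reals all_analysis.
Set Implicit Arguments. Unset Strict Implicit. Unset Printing Implicit Defensive.
Import Order.TTheory GRing.Theory Num.Theory.
Local Open Scope ring_scope.

Section Bandit.
Variables (R : realType) (K T : nat).

(* A history: chronological list of (chosen arm, observed reward). *)
Definition history := seq ('I_K * R).

(* A (behaviourally randomized) policy: given the history, a probability
   vector over the arms for the next pull. *)
Definition policy := history -> 'I_K -> R.

Definition valid_policy (pol : policy) : Prop :=
  forall h : history, (forall k, 0 <= pol h k) /\ \sum_(k < K) pol h k = 1.

(* Mean sequence: mu t k, periods t = 0..T-1, arms k : 'I_K. *)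
Definition means := nat -> 'I_K -> R.

Definition bern (m : R) (b : bool) : R := if b then m else 1 - m.

(* A realized trajectory under Bernoulli rewards: (arm, reward bit) per period. *)
Definition traj := T.-tuple ('I_K * bool).

Definition obs_hist (tr : traj) (t : nat) : history :=
  map (fun p : 'I_K * bool => (p.1, if p.2 then (1:R) else 0)) (take t tr).

Definition traj_prob (pol : policy) (mu : means) (tr : traj) : R :=
  \prod_(t < T) (pol (obs_hist tr t) (tnth tr t).1
                 * bern (mu t (tnth tr t).1) (tnth tr t).2).

Definition expected_reward (pol : policy) (mu : means) : R :=
  \sum_(tr : traj) traj_prob pol mu tr * \sum_(t < T) mu t (tnth tr t).1.

Definition wstart (W : seq nat) (j : nat) : nat := sumn (take j W).

Definition window_benchmark (W : seq nat) (mu : means) : R :=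
  \sum_(j < size W)
     \big[Num.max/0]_(k < K)
        \sum_(wstart W j <= t < wstart W j + nth 0%N W j) mu t k.

Definition regret (W : seq nat) (pol : policy) (mu : means) : R :=
  window_benchmark W mu - expected_reward pol mu.

Definition admissible (V : R) (mu : means) : Prop :=
  (forall t k, 0 <= mu t k <= 1) /\
  \sum_(t < T.-1) \big[Num.max/0]_(k < K) `|mu t k - mu t.+1 k| <= V.

Definition minimax_regret (W : seq nat) (V : R) (pol : policy) : R :=
  sup [set r : R | exists mu, admissible V mu /\ r = regret W pol mu].

End Bandit.

Definition bandit_c (R : realType) : R := 1 / 8 - Num.sqrt (ln (4 / 3 : R)) / 8.

(* Main.v *)
Require Import Defs.
From HB Require Import structures.
From mathcomp Require Import all_boot all_order all_algebra.
From mathcomp Require Import all_classical all_reals all_analysis.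
From mathcomp Require Import ring lra zify.
Import Order.TTheory GRing.Theory Num.Theory.
Import numFieldNormedType.Exports.
Local Open Scope ring_scope.
Set Implicit Arguments. Unset Strict Implicit. Unset Printing Implicit Defensive.

(** Group the windows into batches; in each batch, one arm drawn uniformly at
    random has Bernoulli mean [1/2 + eps] and the others have mean [1/2], where
    [eps = sqrt (K / D) / 4] for a batch of length [D]. Comparing, by the chain
    rule for the relative entropy and Pinsker's inequality, the law of the
    trajectory under these means with its law when no arm of the batch is good,
    one finds that the good arm is pulled on average at most
    [D / K + D * sqrt (ln (4 / 3)) / 2] times, which costs regret at least
    [bandit_c * sqrt (K * D)] per batch. Batches of length at least
    [B = K ^ (1/3) * (T / V) ^ (2/3)] keep the variation below [V]: in (ii) the
    windows themselves are such batches. In (i) they are grouped greedily into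
    batches of length between [B] and [3 * B], or into a single batch, whose
    means are constant, if [T < B]. Grouping only lowers the benchmark. *)

(** * Logarithm inequalities *)

(* The derivative of the rational function minus [ln] is
   [(x - 1) ^ 3 / (x * (1 + 2 * x) ^ 2)], so the difference is minimal at [1]. *)
Lemma oppr_ln_ge (R : realType) (x : R) : 0 < x ->
  (1 - x) * (5 + x) / (2 * (1 + 2 * x)) <= - ln x.
Proof.
move=> x0.
(* [G] is the partial fraction form of the difference of the two sides, up to a constant:
   [G 1 = - 7 / 8]. *)
pose G (y : R) : R := 4^-1 * y + (- (27/8)) * (1 + 2 * y)^-1 - ln y.
pose dG (y : R) : R := (y - 1) ^+ 3 / (y * (1 + 2 * y) ^+ 2).
have dGE (y : R) : 0 < y -> is_derive y 1 G (dG y).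
  move=> y0.
  have := is_derive1_ln y0 => dln.
  have ny : 1 + 2 * y != 0 by apply: lt0r_neq0; lra.
  have dinv : is_derive y 1 (fun z : R => (1 + 2 * z)^-1)
      (- ((1 + 2 * y) ^- 2) *: (2 : R)).
    apply: (@is_deriveV R (fun z : R => 1 + 2 * z) y 2 1) => //.
    apply: is_derive_eq; rewrite /GRing.scale /=.
    by ring.
  apply: is_derive_eq.
  rewrite /dG /GRing.scale /=.
  by field; rewrite ny gt_eqF.
have cG (y : R) : 0 < y -> {for y, continuous G}.
  move=> y0; apply/differentiable_continuous/derivable1_diffP.
  by case: (dGE y y0).
have H : G 1 <= G x.
  have [x1|x1] := leP 1 x.
  - have [||c] := @MVT_segment R G dG 1 x x1.
    + by move=> z; rewrite in_itv /= => /andP[z1 _]; apply: dGE; lra.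
    + apply: continuous_in_subspaceT => z; rewrite inE /= in_itv /= => /andP[z1 _].
      by apply: cG; lra.
    + rewrite in_itv /= => /andP[c1 _] E.
      rewrite -subr_ge0 E mulr_ge0 ?subr_ge0 // /dG divr_ge0 //.
        by rewrite exprn_ge0 // subr_ge0.
      by rewrite mulr_ge0 ?sqr_ge0; lra.
  - have [||c] := @MVT_segment R G dG x 1 (ltW x1).
    + by move=> z; rewrite in_itv /= => /andP[z1 _]; apply: dGE; lra.
    + apply: continuous_in_subspaceT => z; rewrite inE /= in_itv /= => /andP[z1 _].
      by apply: cG; lra.
    + rewrite in_itv /= => /andP[c1 c2] E.
      rewrite -subr_le0 E mulr_le0_ge0 ?subr_ge0 ?(ltW x1) // /dG.
      rewrite mulr_le0_ge0 //; first by rewrite exprn_odd_le0 // subr_le0.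
      by rewrite invr_ge0 mulr_ge0 ?sqr_ge0 //; lra.
have nx : 1 + 2 * x != 0 by apply: lt0r_neq0; lra.
have -> : (1 - x) * (5 + x) / (2 * (1 + 2 * x))
   = - (4^-1 * x + (- (27/8)) * (1 + 2 * x)^-1) - 7 / 8 :> R by field.
have E1 : (1 + 2 * 1)^-1 = 1 / 3 :> R by field.
by move: H; rewrite /G ln1 E1; lra.
Qed.

(* Integrated against the law [p], with [x] the likelihood ratio [q / p], this
   is Pinsker's inequality with the square root linearized by AM-GM. *)
Lemma pinsker_pointwise (R : realType) (x s : R) : 0 < x -> 0 < s ->
  `|x - 1| <= s / 2 * (1 + 2 * x) + (- ln x - 1 + x) / (3 * s).
Proof.
move=> x0 s0; have := oppr_ln_ge x0.
set l := ln x => H.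
have y0 : 0 < 1 + 2 * x by lra.
have s1 : 0 < 3 * s by lra.
(* The logarithmic bound amounts to [3 / 2 * (x - 1) ^+ 2 / (1 + 2 * x) <= - ln x - 1 + x]. *)
apply: (@le_trans _ _ (s / 2 * (1 + 2 * x)
   + (3 / 2 * (x - 1) ^+ 2 / (1 + 2 * x)) / (3 * s))); last first.
  rewrite lerD2l ler_pM2r ?invr_gt0 //.
  suff -> : 3 / 2 * (x - 1) ^+ 2 / (1 + 2 * x) =
     (1 - x) * (5 + x) / (2 * (1 + 2 * x)) - 1 + x by lra.
  by field; rewrite gt_eqF.
(* AM-GM as an identity: the gap is a square over a positive denominator. *)
have -> : s / 2 * (1 + 2 * x) + (3 / 2 * (x - 1) ^+ 2 / (1 + 2 * x)) / (3 * s)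
  = `|x - 1| + (s * (1 + 2 * x) - `|x - 1|) ^+ 2 / (2 * s * (1 + 2 * x)).
  rewrite -[(x - 1) ^+ 2]real_normK ?num_real //.
  by field; rewrite !gt_eqF //; lra.
by rewrite lerDl divr_ge0 ?sqr_ge0 // mulr_ge0 //; lra.
Qed.

(* Concavity of [ln] on [3/4, 1]. *)
Lemma oppr_ln1B_le (R : realType) (x : R) : 0 <= x <= 1 / 4 ->
  - ln (1 - x) <= 4 * ln (4 / 3) * x.
Proof.
move=> /andP[x0 x1].
have t0 : 0 <= 4 * x <= 1 by apply/andP; split; lra.
have t1 : 0 < (3 / 4 : R) by lra.
have := @concave_ln R (Itv01 (andP t0).1 (andP t0).2) _ _ t1 ltr01.
rewrite !convRE /= /unstable.onem ln1 mulr0 addr0 mulr1.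
have -> : ln (3 / 4 : R) = - ln (4 / 3).
  by rewrite -lnV ?posrE ?divr_gt0 // invf_div.
have -> : 4 * x * (3 / 4) + (1 - 4 * x) = 1 - x by field.
by lra.
Qed.

Lemma ln43_bounds (R : realType) : 0 < ln (4 / 3 : R) <= 1 / 3.
Proof.
rewrite ln_gt0 /=; last by lra.
have -> : 4 / 3 = 1 + 1 / 3 :> R by field.
by apply: le_ln1Dx; lra.
Qed.

(** * Expectations over trajectories *)

Lemma big_tuple_rcons (V : nmodType) (A : finType) n
    (F : n.+1.-tuple A -> V) :
  \sum_(u : n.+1.-tuple A) F u =
  \sum_(u : n.-tuple A) \sum_(a : A) F [tuple of rcons u a].
Proof.
rewrite pair_bigA /=.
rewrite (reindex (fun q : n.-tuple A * A => [tuple of rcons q.1 q.2])) //.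
apply: onW_bij; apply: inj_card_bij.
  move=> [u a] [v b] /(congr1 val) /= /rcons_inj [/val_inj -> ->] //.
by rewrite card_prod !card_tuple expnSr.
Qed.

Definition pull_prob (R : realType) K (pol : policy R K) (mu : means R K)
    (t : nat) (h : seq ('I_K * bool)) (p : 'I_K * bool) : R :=
  pol [seq (q.1, if q.2 then (1 : R) else 0) | q <- h] p.1
  * bern (mu t p.1) p.2.

Definition expect (R : realType) K T (pol : policy R K) (mu : means R K)
    (F : traj K T -> R) : R :=
  \sum_tr traj_prob pol mu tr * F tr.

Lemma tnth_rcons_widen (A : eqType) n (u : n.-tuple A) (a : A) (i : 'I_n) :
  tnth [tuple of rcons u a] (widen_ord (leqnSn n) i) = tnth u i.
Proof. by rewrite !(tnth_nth a) /= nth_rcons size_tuple ltn_ord. Qed.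

Lemma tnth_rcons_max (A : eqType) n (u : n.-tuple A) (a : A) :
  tnth [tuple of rcons u a] ord_max = a.
Proof. by rewrite (tnth_nth a) /= nth_rcons size_tuple ltnn eqxx. Qed.

Lemma take_rcons_tuple (A : Type) n (u : n.-tuple A) (a : A) t :
  (t <= n)%N -> take t (rcons u a) = take t u.
Proof. by move=> tn; rewrite -cats1 takel_cat ?size_tuple. Qed.

Lemma traj_prob_rcons (R : realType) K n (pol : policy R K) (mu : means R K)
    (tr : traj K n) p :
  traj_prob pol mu ([tuple of rcons tr p] : traj K n.+1) =
  traj_prob pol mu tr * pull_prob pol mu n tr p.
Proof.
rewrite /traj_prob big_ord_recr /= tnth_rcons_max /obs_hist /=.
rewrite take_rcons_tuple // take_oversize ?size_tuple //; congr (_ * _).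
apply: eq_bigr => i _; rewrite tnth_rcons_widen take_rcons_tuple //.
exact: ltnW.
Qed.

(** The tower property at the last period; inductions on the horizon peel off that period with
    it. *)
Lemma expect_rcons (R : realType) K n (pol : policy R K) (mu : means R K)
    (F : traj K n.+1 -> R) :
  expect pol mu F =
  expect pol mu (fun tr : traj K n =>
    \sum_p pull_prob pol mu n tr p * F [tuple of rcons tr p]).
Proof.
rewrite /expect big_tuple_rcons; apply: eq_bigr => tr _.
rewrite mulr_sumr; apply: eq_bigr => p _.
by rewrite traj_prob_rcons mulrA.
Qed.

Lemma sum_pair_bool (V : nmodType) K (F : 'I_K * bool -> V) :
  \sum_p F p = \sum_k (F (k, true) + F (k, false)).
Proof.
rewrite (eq_bigr (fun p => F (p.1, p.2))) => [|[] //].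
rewrite -(pair_bigA _ (fun k b => F (k, b))) /=.
by apply: eq_bigr => k _; rewrite big_bool.
Qed.

Lemma sum_pull_prob (R : realType) K (pol : policy R K) (mu : means R K) t h :
  valid_policy pol -> \sum_p pull_prob pol mu t h p = 1.
Proof.
move=> /(_ [seq (q.1, if q.2 then (1 : R) else 0) | q <- h])[_ <-].
rewrite sum_pair_bool; apply: eq_bigr => k _.
by rewrite /pull_prob /= -mulrDr addrC subrK mulr1.
Qed.

Lemma expect1 (R : realType) K T (pol : policy R K) (mu : means R K) :
  valid_policy pol -> expect pol mu (fun _ : traj K T => 1) = 1.
Proof.
move=> vp; elim: T => [|n IH].
  rewrite /expect (eq_bigr (fun=> 1)) => [|tr _]; last first.
    by rewrite /traj_prob big_ord0 mulr1.
  by rewrite sumr_const card_tuple expn0.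
rewrite expect_rcons -[RHS]IH; apply: eq_bigr => tr _; congr (_ * _).
by under eq_bigr do rewrite mulr1; rewrite sum_pull_prob.
Qed.

Lemma expectD (R : realType) K T (pol : policy R K) (mu : means R K)
    (F G : traj K T -> R) :
  expect pol mu (fun tr => F tr + G tr) = expect pol mu F + expect pol mu G.
Proof.
by rewrite /expect -big_split; apply: eq_bigr => tr _; rewrite mulrDr.
Qed.

Lemma expectZ (R : realType) K T (pol : policy R K) (mu : means R K) a
    (F : traj K T -> R) :
  expect pol mu (fun tr => a * F tr) = a * expect pol mu F.
Proof.
by rewrite /expect mulr_sumr; apply: eq_bigr => tr _; rewrite mulrCA.
Qed.

Lemma expect_sum (R : realType) K T (pol : policy R K) (mu : means R K)
    (I : finType) (F : I -> traj K T -> R) :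
  expect pol mu (fun tr => \sum_i F i tr) = \sum_i expect pol mu (F i).
Proof.
rewrite /expect exchange_big /=; apply: eq_bigr => tr _.
by rewrite mulr_sumr.
Qed.

Lemma eq_expect (R : realType) K T (pol : policy R K) (mu : means R K)
    (F G : traj K T -> R) : F =1 G -> expect pol mu F = expect pol mu G.
Proof. by move=> FG; apply: eq_bigr => tr _; rewrite FG. Qed.

Lemma expect_cst (R : realType) K T (pol : policy R K) (mu : means R K) a :
  valid_policy pol -> expect pol mu (fun _ : traj K T => a) = a.
Proof.
move=> vp; rewrite -[RHS]mulr1 -(expect1 T mu vp) -expectZ.
by apply: eq_expect => tr; rewrite mulr1.
Qed.

Lemma bern_ge0 (R : realType) (m : R) b : 0 <= m <= 1 -> 0 <= bern m b.
Proof. by case/andP=> m0 m1; case: b; rewrite //= subr_ge0. Qed.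

Lemma traj_prob_ge0 (R : realType) K T (pol : policy R K) (mu : means R K)
    (tr : traj K T) :
  valid_policy pol -> (forall t k, 0 <= mu t k <= 1) ->
  0 <= traj_prob pol mu tr.
Proof.
move=> vp mu01; apply: prodr_ge0 => t _; apply: mulr_ge0.
  exact: (vp _).1.
exact: bern_ge0.
Qed.

Lemma ler_expect (R : realType) K T (pol : policy R K) (mu : means R K)
    (F G : traj K T -> R) :
  valid_policy pol -> (forall t k, 0 <= mu t k <= 1) ->
  (forall tr, F tr <= G tr) -> expect pol mu F <= expect pol mu G.
Proof.
move=> vp mu01 FG; apply: ler_sum => tr _.
by apply: ler_wpM2l => //; apply: traj_prob_ge0.
Qed.

(* Replaces each summand by its conditional expectation given the past. *)
Lemma expect_compensator (R : realType) K T (pol : policy R K)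
    (mu : means R K) (phi : nat -> seq ('I_K * bool) -> 'I_K * bool -> R) :
  valid_policy pol ->
  expect pol mu
    (fun tr : traj K T => \sum_(t < T) phi t (take t tr) (tnth tr t)) =
  expect pol mu
    (fun tr : traj K T => \sum_(t < T) \sum_p
       pull_prob pol mu t (take t tr) p * phi t (take t tr) p).
Proof.
move=> vp; elim: T => [|n IH].
  by apply: eq_bigr => tr _; rewrite !big_ord0.
rewrite !expect_rcons.
pose A (tr : traj K n) := \sum_(t < n) phi t (take t tr) (tnth tr t).
pose B (tr : traj K n) := \sum_(t < n) \sum_p
       pull_prob pol mu t (take t tr) p * phi t (take t tr) p.
pose C (tr : traj K n) := \sum_p pull_prob pol mu n tr p * phi n tr p.
transitivity (expect pol mu (fun tr => A tr + C tr)).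
  apply: eq_expect => tr.
  (* [A tr] is multiplied by the total mass 1 of the next pull, so that it enters the sum over
     [p]. *)
  rewrite -[A tr]mul1r -(sum_pull_prob mu n tr vp) mulr_suml -big_split /=.
  apply: eq_bigr => p _; rewrite -mulrDr; congr (_ * _).
  rewrite big_ord_recr /= tnth_rcons_max take_rcons_tuple //.
  rewrite take_oversize ?size_tuple //; congr (_ + _).
  apply: eq_bigr => i _; rewrite tnth_rcons_widen take_rcons_tuple //.
  exact: ltnW.
rewrite expectD IH -expectD; apply: eq_expect => tr.
rewrite -[LHS]mul1r -(sum_pull_prob mu n tr vp) mulr_suml.
apply: eq_bigr => p _; congr (_ * _).
rewrite big_ord_recr /= take_rcons_tuple // take_oversize ?size_tuple //.
by congr (_ + _); apply: eq_bigr => i _; rewrite take_rcons_tuple // ltnW.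
Qed.

(** * Change of measure *)

(** The choice probabilities of the policy cancel in the likelihood ratio of two trajectory laws, so
    only the Bernoulli factors remain. The expectation under [mu] is minus a relative entropy. *)
Definition log_lr (R : realType) K (mu nu : means R K) (t : nat)
    (p : 'I_K * bool) : R :=
  ln (bern (nu t p.1) p.2 / bern (mu t p.1) p.2).

Definition traj_log_lr (R : realType) K T (mu nu : means R K)
    (tr : traj K T) : R :=
  \sum_(t < T) log_lr mu nu t (tnth tr t).

Lemma bern_gt0 (R : realType) (m : R) b : 0 < m < 1 -> 0 < bern m b.
Proof. by case/andP=> m0 m1; case: b; rewrite //= subr_gt0. Qed.

Lemma traj_prob_lr (R : realType) K T (pol : policy R K) (mu nu : means R K)
    (tr : traj K T) :
  (forall t k, 0 < mu t k < 1) -> (forall t k, 0 < nu t k < 1) ->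
  traj_prob pol nu tr = traj_prob pol mu tr * expR (traj_log_lr mu nu tr).
Proof.
move=> mu01 nu01; rewrite /traj_prob expR_sum -big_split /=.
apply: eq_bigr => t _; rewrite lnK; last first.
  by rewrite posrE divr_gt0 // bern_gt0.
rewrite -mulrA; congr (_ * _); rewrite mulrC divfK // gt_eqF //.
exact: bern_gt0.
Qed.

Lemma expect_lr (R : realType) K T (pol : policy R K) (mu nu : means R K)
    (F : traj K T -> R) :
  (forall t k, 0 < mu t k < 1) -> (forall t k, 0 < nu t k < 1) ->
  expect pol nu F =
  expect pol mu (fun tr => expR (traj_log_lr mu nu tr) * F tr).
Proof.
move=> mu01 nu01; apply: eq_bigr => tr _.
by rewrite (traj_prob_lr _ _ mu01 nu01) mulrA.
Qed.

(** Both laws have mass 1, so [F] may be centred at [D / 2], which leaves [D / 2] times the L1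
    distance of the laws. That distance is bounded by integrating [pinsker_pointwise] under [mu]:
    the likelihood ratio has mean 1, so [1 + 2 * x] contributes 3. *)
Lemma expect_transport (R : realType) K T (pol : policy R K)
    (mu nu : means R K) (F : traj K T -> R) (D s : R) :
  valid_policy pol ->
  (forall t k, 0 < mu t k < 1) -> (forall t k, 0 < nu t k < 1) ->
  0 < s -> (forall tr, 0 <= F tr <= D) ->
  expect pol nu F <= expect pol mu F + D / 2 *
    (3 * s / 2 - expect pol mu (traj_log_lr mu nu (T := T)) / (3 * s)).
Proof.
move=> vp mu01 nu01 s0 FD.
pose L tr := expR (@traj_log_lr R K T mu nu tr).
have EL : expect pol mu L = 1.
  rewrite -(expect1 T nu vp) (expect_lr _ _ mu01 nu01).
  by apply: eq_expect => tr; rewrite mulr1.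
(* Coefficients of 1, of the likelihood ratio [L] and of its logarithm in [D / 2 * (L - 1)] plus
   [D / 2] times the Pinsker bound. *)
pose a := D / 2 * (- 1 + s / 2 - (3 * s)^-1).
pose b := D / 2 * (1 + s + (3 * s)^-1).
pose c := - (D / 2 / (3 * s)).
rewrite (expect_lr _ _ mu01 nu01).
apply: (@le_trans _ _ (expect pol mu (fun tr => F tr + (a + (b * L tr
    + c * traj_log_lr mu nu tr))))); last first.
  rewrite expectD expectD expectD !expectZ EL expect_cst //.
  by rewrite lerD2l /a /b /c le_eqVlt; apply/orP; left; apply/eqP; field; lra.
apply: ler_expect => // [t k|tr].
  by case/andP: (mu01 t k) => ? ?; rewrite !ltW.
rewrite -/(L tr); have L0 : 0 < L tr by exact: expR_gt0.
have /andP[F0 F1] := FD tr.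
have -> : traj_log_lr mu nu tr = ln (L tr) by rewrite expRK.
have D0 : 0 <= D by apply: le_trans F1.
have P := ler_wpM2l (ltac:(lra) : 0 <= D / 2) (pinsker_pointwise L0 s0).
apply: (@le_trans _ _ (F tr + D / 2 * (L tr - 1) + D / 2 * `|L tr - 1|)).
  suff : (L tr - 1) * (F tr - D / 2) <= D / 2 * `|L tr - 1| by lra.
  rewrite (le_trans (ler_norm _)) // normrM mulrC ler_wpM2r //.
  by rewrite ler_norml; apply/andP; split; lra.
rewrite -addrA lerD2l.
apply: (le_trans (lerD (lexx _) P)).
rewrite /a /b /c le_eqVlt; apply/orP; left; apply/eqP; field; lra.
Qed.

Definition bern_kl (R : realType) (m n : R) : R :=
  - (m * ln (n / m) + (1 - m) * ln ((1 - n) / (1 - m))).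

(** The chain rule for the relative entropy: given the past, pulling arm [k] in period [t]
    contributes [- bern_kl (mu t k) (nu t k)]. *)
Lemma expect_log_lr (R : realType) K T (pol : policy R K)
    (mu nu : means R K) (d : R) (P : nat -> 'I_K -> bool) :
  valid_policy pol ->
  (forall t k, bern_kl (mu t k) (nu t k) = d * (P t k)%:R) ->
  expect pol mu (traj_log_lr mu nu (T := T)) =
  - (d * expect pol mu (fun tr : traj K T =>
     \sum_(t < T) (P t (tnth tr t).1)%:R)).
Proof.
move=> vp H.
rewrite -mulNr.
rewrite [LHS](expect_compensator T mu (fun t _ p => log_lr mu nu t p)) //.
rewrite [in RHS](expect_compensator T mu (fun t _ p => (P t p.1)%:R)) //.
rewrite -expectZ; apply: eq_expect => tr.
rewrite mulr_sumr; apply: eq_bigr => t _.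
rewrite !sum_pair_bool mulr_sumr; apply: eq_bigr => k _.
rewrite /pull_prob /log_lr /=.
set h := pol _ _.
transitivity (h * - bern_kl (mu t k) (nu t k)); first by rewrite /bern_kl; ring.
by rewrite H; ring.
Qed.

Lemma bern_kl_id (R : realType) (m : R) : 0 < m < 1 -> bern_kl m m = 0.
Proof.
move=> /andP[m0 m1]; rewrite /bern_kl !divff ?ln1 ?mulr0 ?addr0 ?oppr0 //.
  by rewrite gt_eqF // subr_gt0.
by rewrite gt_eqF.
Qed.

Lemma bern_kl_half (R : realType) (e : R) : 0 <= e < 1 / 2 ->
  bern_kl (1 / 2) (1 / 2 + e) = - ln (1 - 4 * e ^+ 2) / 2.
Proof.
move=> /andP[e0 e1]; rewrite /bern_kl.
have -> : (1 / 2 + e) / (1 / 2) = 1 + 2 * e by field.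
have -> : (1 - (1 / 2 + e)) / (1 - 1 / 2) = 1 - 2 * e by field.
have -> : 1 - 4 * e ^+ 2 = (1 + 2 * e) * (1 - 2 * e) by ring.
by rewrite lnM ?posrE; lra.
Qed.

(** * Random good arms *)

(* [g j = Some k] makes [k] the good arm of batch [j]; [g j = None] leaves all
   the arms of batch [j] at mean [1/2]. *)
Definition batch_means (R : realType) K m (b : nat -> 'I_m) (eps : 'I_m -> R)
    (g : 'I_m -> option 'I_K) : means R K :=
  fun t k => 1 / 2 + (if g (b t) == Some k then eps (b t) else 0).

Definition set_batch K m (g : 'I_m -> option 'I_K) i (o : option 'I_K) :
    'I_m -> option 'I_K :=
  fun j => if j == i then o else g j.

Definition batch_size T m (b : nat -> 'I_m) (i : 'I_m) : nat :=
  (\sum_(t < T) (b t == i))%N.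

Definition pulls (R : realType) K T m (b : nat -> 'I_m) i k
    (tr : traj K T) : R :=
  \sum_(t < T) ((b t == i) && ((tnth tr t).1 == k))%:R.

Lemma pulls_bounds (R : realType) K T m (b : nat -> 'I_m) i k
    (tr : traj K T) :
  0 <= pulls R b i k tr <= (batch_size T b i)%:R.
Proof.
rewrite sumr_ge0 //= natr_sum; apply: ler_sum => t _.
by rewrite ler_nat; do 2!case: (_ == _).
Qed.

Lemma sum_pulls (R : realType) K T m (b : nat -> 'I_m) i (tr : traj K T) :
  \sum_k pulls R b i k tr = (batch_size T b i)%:R.
Proof.
rewrite exchange_big natr_sum; apply: eq_bigr => t _ /=.
rewrite (bigD1 (tnth tr t).1) //= eqxx andbT big1 ?addr0 // => k.
by rewrite eq_sym => /negPf ->; rewrite andbF.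
Qed.

Lemma batch_means_bounds (R : realType) K m (b : nat -> 'I_m)
    (eps : 'I_m -> R) (g : 'I_m -> option 'I_K) t k :
  (forall i, 0 <= eps i <= 1 / 4) -> 0 < batch_means b eps g t k < 1.
Proof.
move=> /(_ (b t)) /andP[e0 e1]; rewrite /batch_means.
by case: ifP => _; apply/andP; split; lra.
Qed.

(** All [K] choices of the good arm are compared with one reference law, under which batch [i] has
    none. There the pulls of the batch sum to [D] over the arms, so the relative entropies sum to
    [d * D]. *)
Lemma sum_expect_pulls_le (R : realType) K T m (b : nat -> 'I_m)
    (eps : 'I_m -> R) (g : 'I_m -> option 'I_K) (pol : policy R K) i :
  let D := batch_size T b i in
  valid_policy pol -> (0 < K)%N -> (K <= D)%N ->
  (forall j, 0 <= eps j <= 1 / 4) -> eps i = Num.sqrt (K%:R / D%:R) / 4 ->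
  \sum_k expect pol (batch_means b eps (set_batch g i (Some k)))
      (pulls R b i k (T := T)) <=
  D%:R + K%:R * D%:R * Num.sqrt (ln (4 / 3)) / 2.
Proof.
move=> D vp K0 KD eps01 epsi.
have /andP[l0 l1] := ln43_bounds R.
set l := ln (4 / 3) in l0 l1 *.
have q0 : 0 < Num.sqrt l by rewrite sqrtr_gt0.
(* With [s = sqrt l / 3], both terms of [expect_transport], averaged over the arms, are bounded by
   [sqrt l / 2]. *)
have s0 : 0 < Num.sqrt l / 3 by rewrite divr_gt0.
have KR : 0 < K%:R :> R by rewrite ltr0n.
have DR : 0 < D%:R :> R by rewrite ltr0n (leq_trans K0).
pose mu0 := batch_means b eps (set_batch g i None).
pose nu k := batch_means b eps (set_batch g i (Some k)).
pose d := - ln (1 - 4 * eps i ^+ 2) / 2.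
have kl k t a : bern_kl (mu0 t a) (nu k t a) = d * ((b t == i) && (a == k))%:R.
  have [bti|bti] := eqVneq (b t) i; last first.
    have -> : nu k t a = mu0 t a.
      by rewrite /nu /mu0 /batch_means /set_batch (negPf bti).
    by rewrite bern_kl_id ?mulr0 //; exact: batch_means_bounds.
  rewrite /nu /mu0 /batch_means /set_batch bti eqxx /= addr0.
  rewrite (inj_eq Some_inj) eq_sym; case: eqP => _ /=.
    by rewrite bern_kl_half ?mulr1 //; have := eps01 i; lra.
  by rewrite addr0 bern_kl_id ?mulr0 //; lra.
have step k : expect pol (nu k) (pulls R b i k (T := T)) <=
    expect pol mu0 (pulls R b i k (T := T)) + D%:R / 2 *
    (3 * (Num.sqrt l / 3) / 2
     + d * expect pol mu0 (pulls R b i k (T := T)) / (3 * (Num.sqrt l / 3))).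
  have := @expect_transport R K T pol mu0 (nu k) _ D%:R _ vp
    (fun t a => batch_means_bounds _ _ _ _ eps01)
    (fun t a => batch_means_bounds _ _ _ _ eps01) s0
    (pulls_bounds R b i k).
  rewrite (expect_log_lr T (P := fun t a => (b t == i) && (a == k)) vp (kl k)).
  by rewrite mulNr opprK.
have E0 : \sum_k expect pol mu0 (pulls R b i k (T := T)) = D%:R.
  rewrite -expect_sum -[RHS](expect_cst T mu0 _ vp).
  by apply: eq_expect => tr; exact: sum_pulls.
apply: (le_trans (ler_sum _ (fun k _ => step k))).
rewrite big_split /= E0 -mulr_sumr big_split /= sumr_const card_ord.
rewrite -mulr_suml -mulr_sumr E0 -[_ / 2 *+ K]mulr_natr.
have eps2 : eps i ^+ 2 = K%:R / D%:R / 16.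
  rewrite epsi expr_div_n sqr_sqrtr ?divr_ge0 //.
  by congr (_ / _); ring.
have KD1 : K%:R / D%:R <= 1 :> R by rewrite ler_pdivrMr // mul1r ler_nat.
have KD0 : 0 <= K%:R / D%:R :> R by rewrite divr_ge0.
have dle : d * D%:R <= l * K%:R / 2.
  have : d <= l / 2 * (K%:R / D%:R).
    (* Here [4 * eps i ^+ 2 = K / (4 * D)] is at most [1 / 4] because [K <= D]; this is where
       [ln (4 / 3)] arises. *)
    have := @oppr_ln1B_le R (4 * eps i ^+ 2).
    by rewrite /d eps2 -/l; lra.
  rewrite -(ler_pM2r DR) => /le_trans; apply.
  by rewrite le_eqVlt; apply/orP; left; apply/eqP; field; rewrite gt_eqF.
have q2 : Num.sqrt l * Num.sqrt l = l by rewrite -expr2 sqr_sqrtr // ltW.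
have : d * D%:R / (3 * (Num.sqrt l / 3)) <= Num.sqrt l * K%:R / 2.
  rewrite ler_pdivrMr; last by lra.
  apply: (le_trans dle); rewrite -{1}q2 le_eqVlt; apply/orP; left.
  by apply/eqP; field.
move=> H; rewrite lerD2l.
apply: (le_trans (ler_wpM2l _ (lerD (lexx _) H))); first by lra.
by rewrite le_eqVlt; apply/orP; left; apply/eqP; field.
Qed.

(** Redrawing one coordinate of a uniform function leaves it uniform: exchanging [g i] with [a] is
    an involution. *)
Lemma sum_ffun_set (V : nmodType) (I A : finType) (i : I)
    (F : {ffun I -> A} -> V) :
  \sum_(g : {ffun I -> A}) \sum_a F [ffun j => if j == i then a else g j] =
  (\sum_(g : {ffun I -> A}) F g) *+ #|A|.
Proof.
rewrite pair_bigA /=.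
pose f (q : {ffun I -> A} * A) : {ffun I -> A} * A :=
  ([ffun j => if j == i then q.2 else q.1 j], q.1 i).
rewrite (reindex_inj (h := f)) /=; last first.
  apply: (can_inj (g := f)) => -[g a]; rewrite /f /= ffunE eqxx; congr pair.
  by apply/ffunP => j; rewrite !ffunE; case: eqP => // ->.
rewrite -(pair_bigA _ (fun (g : {ffun I -> A}) (a : A) =>
  F [ffun j => if j == i then g i else (f (g, a)).1 j])) /=.
rewrite -sumrMnl; apply: eq_bigr => g _.
rewrite -sumr_const; apply: eq_bigr => a _; congr F.
by apply/ffunP => j; rewrite !ffunE; case: eqP => // ->.
Qed.

(** The probabilistic method: the bound holds on average over all [g]. For batch [i], only its good
    arm is redrawn while those of the other batches stay fixed. *)
Lemma exists_good_arms (R : realType) K T m (b : nat -> 'I_m)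
    (eps : 'I_m -> R) (pol : policy R K) :
  valid_policy pol -> (2 <= K)%N -> (forall i, K <= batch_size T b i)%N ->
  (forall i, eps i = Num.sqrt (K%:R / (batch_size T b i)%:R) / 4) ->
  exists g : {ffun 'I_m -> 'I_K},
  bandit_c R * \sum_i Num.sqrt (K%:R * (batch_size T b i)%:R) <=
  \sum_i eps i * ((batch_size T b i)%:R
    - expect pol (batch_means b eps (Some \o g)) (pulls R b i (g i) (T := T))).
Proof.
move=> vp K2 KD epsE.
have K0 : (0 < K)%N by apply: leq_trans K2.
have DR i : 0 < (batch_size T b i)%:R :> R.
  by rewrite ltr0n (leq_trans K0).
have KR : 2 <= K%:R :> R by rewrite ler_nat.
have eps01 i : 0 <= eps i <= 1 / 4.
  rewrite epsE divr_ge0 ?sqrtr_ge0 //= ler_pM2r // -[leRHS]sqrtr1.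
  by rewrite ler_sqrt // ler_pdivrMr // mul1r ler_nat.
pose M g i := expect pol (batch_means b eps (Some \o g))
  (pulls R b i (g i) (T := T)).
pose c := bandit_c R.
have avg i : c * Num.sqrt (K%:R * (batch_size T b i)%:R) *+ #|{ffun 'I_m -> 'I_K}|
   <= \sum_(g : {ffun 'I_m -> 'I_K}) eps i * ((batch_size T b i)%:R - M g i).
  have := sum_ffun_set i (fun g : {ffun 'I_m -> 'I_K} =>
    eps i * ((batch_size T b i)%:R - M g i)).
  rewrite card_ord -(ler_pMn2r K0) => <-.
  rewrite -mulrnA mulnC mulrnA -sumr_const.
  apply: ler_sum => g _.
  rewrite -mulr_sumr sumrB sumr_const card_ord.
  have := sum_expect_pulls_le (Some \o g) vp K0 (KD i) eps01 (epsE i).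
  set D : R := _%:R; set S := \sum_k _; set S' := \sum_k _ => SE.
  have -> : S' = S.
    apply: eq_bigr => k _; rewrite /M ffunE eqxx; congr expect.
    congr batch_means; apply/funext => j; rewrite /set_batch /= ffunE.
    by case: ifP.
  have D0 : 0 < D by exact: DR.
  have -> : Num.sqrt (K%:R * D) = Num.sqrt (K%:R / D) * D.
    rewrite -{3}(ger0_norm (ltW D0)) -sqrtr_sqr -sqrtrM; last first.
      by rewrite divr_ge0 // ltW.
    by congr Num.sqrt; field; rewrite gt_eqF.
  have -> : Num.sqrt (K%:R / D) = 4 * eps i by rewrite epsE; field.
  rewrite -[_ *+ K]mulr_natr -[D *+ K]mulr_natr.
  have /andP[e0 _] := eps01 i.
  (* Since [K >= 2], the term [D] is at most [K * D / 2], which leaves the factor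
     [1 / 2 - sqrt (ln (4 / 3)) / 2]. Dividing by the 4 in [sqrt (K * D) = 4 * eps i * D] gives
     [bandit_c]. *)
  apply: (@le_trans _ _ (eps i * (D * K%:R * (1 / 2 - Num.sqrt (ln (4/3)) / 2)))).
    by rewrite /c /bandit_c le_eqVlt; apply/orP; left; apply/eqP; field.
  apply: ler_wpM2l => //.
  have := ler_wpM2r (ltW D0) KR.
  move: SE; set q := Num.sqrt _; lra.
(* The strict comparison of sums below needs at least one summand. *)
have [g0 _] : exists g0 : {ffun 'I_m -> 'I_K}, True.
  by exists [ffun=> Ordinal K0].
pose Obj (g : {ffun 'I_m -> 'I_K}) :=
  \sum_i eps i * ((batch_size T b i)%:R - M g i).
apply: contrapT => /forallNP N.
suff : \sum_(g : {ffun 'I_m -> 'I_K}) Obj g <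
       \sum_(g : {ffun 'I_m -> 'I_K})
          c * \sum_i Num.sqrt (K%:R * (batch_size T b i)%:R).
  rewrite ltNge => /negP; apply.
  rewrite /Obj exchange_big /= sumr_const mulr_sumr -sumrMnl.
  by apply: ler_sum => i _; exact: avg.
apply: ltr_sum => [|g _]; first by apply/hasP; exists g0; rewrite // mem_index_enum.
by rewrite ltNge; apply/negP; exact: N.
Qed.

(** * From batches to the minimax regret *)

Lemma wstart_cons w W j : wstart (w :: W) j.+1 = (w + wstart W j)%N.
Proof. by []. Qed.

Lemma sum_windows_from (V : nmodType) s (W : seq nat) (F : nat -> V) :
  \sum_(j < size W) \sum_(s + wstart W j <= t < s + wstart W j + nth 0%N W j) F t
  = \sum_(s <= t < s + sumn W) F t.
Proof.
elim: W s => [|w W IH] s /=; first by rewrite big_ord0 addn0 big_geq.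
rewrite big_ord_recl /= addn0.
rewrite [RHS](big_cat_nat (leq_addr w s)) ?leq_add2l ?leq_addr //=.
rewrite [(s + (w + _))%N]addnA -IH; congr (_ + _).
by apply: eq_bigr => j _; rewrite wstart_cons addnA.
Qed.

Lemma sum_windows (V : nmodType) (W : seq nat) (F : nat -> V) :
  \sum_(j < size W) \sum_(wstart W j <= t < wstart W j + nth 0%N W j) F t
  = \sum_(t < sumn W) F t.
Proof. by rewrite -(big_mkord xpredT) -[sumn W]add0n -sum_windows_from. Qed.

(** The offset [s] allows induction on the list: the windows after the first form a benchmark of the
    same shape, started later. *)
Definition benchmark_from (R : realType) K s (W : seq nat) (mu : means R K) : R :=
  \sum_(j < size W) \big[Num.max/0]_(k < K)
    \sum_(s + wstart W j <= t < s + wstart W j + nth 0%N W j) mu t k.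

Lemma benchmark_from_cons (R : realType) K s w W (mu : means R K) :
  benchmark_from s (w :: W) mu =
  \big[Num.max/0]_(k < K) (\sum_(s <= t < s + w) mu t k)
  + benchmark_from (s + w) W mu.
Proof.
rewrite /benchmark_from /= big_ord_recl /= addn0; congr (_ + _).
by apply: eq_bigr => j _; rewrite wstart_cons addnA.
Qed.

Lemma benchmark_from_cat (R : realType) K s W1 W2 (mu : means R K) :
  benchmark_from s (W1 ++ W2) mu =
  benchmark_from s W1 mu + benchmark_from (s + sumn W1) W2 mu.
Proof.
elim: W1 s => [|w W1 IH] s /=; first by rewrite {2}/benchmark_from big_ord0 add0r addn0.
by rewrite !benchmark_from_cons IH addrA addnA.
Qed.

Lemma benchmark_from_ge (R : realType) K s W (mu : means R K) k :
  \sum_(s <= t < s + sumn W) mu t k <= benchmark_from s W mu.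
Proof.
rewrite -sum_windows_from; apply: ler_sum => j _.
exact: (le_bigmax _ (fun k => \sum_(_ <= t < _) mu t k)).
Qed.

(** An arm kept fixed throughout a merged window earns no more than the best arms of its parts. *)
Lemma benchmark_from_flatten (R : realType) K s Ws (mu : means R K) :
  benchmark_from s [seq sumn W | W <- Ws] mu <= benchmark_from s (flatten Ws) mu.
Proof.
elim: Ws s => [|W Ws IH] s //=.
rewrite benchmark_from_cons benchmark_from_cat; apply: lerD => //.
apply: bigmax_le => [|k _]; last exact: benchmark_from_ge.
by apply: sumr_ge0 => j _; exact: bigmax_ge_id.
Qed.

Lemma regret_flatten (R : realType) K T Ws (pol : policy R K) (mu : means R K) :
  regret T [seq sumn W | W <- Ws] pol mu <= regret T (flatten Ws) pol mu.
Proof. by rewrite lerD2r; exact: (benchmark_from_flatten 0). Qed.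

(** [sup] dominates the members of a set that is bounded above; here [T] is a bound, as rewards are
    nonnegative and means are at most 1. *)
Lemma regret_le_minimax (R : realType) K T W V (pol : policy R K) (mu : means R K) :
  valid_policy pol -> sumn W = T -> admissible T V mu ->
  regret T W pol mu <= minimax_regret T W V pol.
Proof.
move=> vp WT adm; apply: ub_le_sup; last by exists mu.
exists T%:R => _ [nu [[nu01 _] ->]].
rewrite /regret lerBlDr ler_wpDr //.
  apply: sumr_ge0 => tr _; apply: mulr_ge0; first exact: traj_prob_ge0.
  by apply: sumr_ge0 => t _; case/andP: (nu01 t (tnth tr t).1).
apply: (@le_trans _ _ (\sum_(t < sumn W) 1)); last by rewrite sumr_const card_ord WT.
rewrite -[leRHS](sum_windows W (fun=> 1)); apply: ler_sum => j _.
apply: bigmax_le => [|k _]; first by apply: sumr_ge0.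
by apply: ler_sum => t _; case/andP: (nu01 t k).
Qed.

Lemma window_batch T W (b : nat -> 'I_(size W)) (j : 'I_(size W)) t :
  sumn W = T ->
  (forall t, (t < T)%N -> val (b t) = reshape_index W t) ->
  (wstart W j <= t)%N -> (t < wstart W j + nth 0%N W j)%N -> b t = j.
Proof.
move=> WT bE t1 t2.
have ct : (t - wstart W j < nth 0%N W j)%N by lia.
have E : t = flatten_index W j (t - wstart W j).
  by rewrite /flatten_index -/(wstart W j) subnKC.
have tT : (t < T)%N by rewrite -WT E flatten_indexP.
by apply: val_inj; rewrite bE // {1}E flatten_indexKl.
Qed.

(** The benchmark is at least what the good arms earn. Each pull earns [1 / 2], plus [eps] if it
    hits the good arm, so the regret is at least [eps] per missed pull. *)
Lemma regret_batches (R : realType) K T W (b : nat -> 'I_(size W))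
    (eps : 'I_(size W) -> R) (pol : policy R K) (g : 'I_(size W) -> 'I_K) :
  valid_policy pol -> sumn W = T -> (forall i, 0 <= eps i) ->
  (forall t, (t < T)%N -> val (b t) = reshape_index W t) ->
  \sum_i eps i * ((batch_size T b i)%:R
    - expect pol (batch_means b eps (Some \o g)) (pulls R b i (g i) (T := T)))
  <= regret T W pol (batch_means b eps (Some \o g)).
Proof.
move=> vp WT eps0 bE; set mu := batch_means b eps _.
have -> : \sum_i eps i * ((batch_size T b i)%:R
    - expect pol mu (pulls R b i (g i) (T := T))) =
  \sum_(t < T) (1 / 2 + eps (b t)) - expected_reward T pol mu.
  have -> : expected_reward T pol mu = expect pol mu
     (fun tr : traj K T => \sum_(t < T) (1 / 2)
        + \sum_i eps i * pulls R b i (g i) tr).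
    apply: eq_expect => tr.
    under [X in _ = _ + X]eq_bigr do rewrite mulr_sumr.
    rewrite exchange_big -big_split /=; apply: eq_bigr => t _.
    rewrite /mu /batch_means; congr (_ + _).
    rewrite (bigD1 (b t)) //= big1 ?addr0 => [|i].
      by rewrite eqxx (inj_eq Some_inj) eq_sym; case: eqP; rewrite ?mulr1 ?mulr0.
    by rewrite eq_sym => /negPf ->; rewrite mulr0.
  rewrite expectD expect_cst // expect_sum big_split /= opprD addrACA subrr add0r.
  under eq_bigr do rewrite mulrBr.
  rewrite sumrB; congr (_ - _); last by apply: eq_bigr => i _; rewrite expectZ.
  transitivity (\sum_i \sum_(t < T) eps i * (b t == i)%:R).
    by apply: eq_bigr => i _; rewrite /batch_size natr_sum mulr_sumr.
  rewrite exchange_big; apply: eq_bigr => t _ /=.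
  rewrite (bigD1 (b t)) //= big1 ?addr0 ?eqxx ?mulr1 // => i.
  by rewrite eq_sym => /negPf ->; rewrite mulr0.
have := sum_windows W (fun t => 1 / 2 + eps (b t)); rewrite WT lerD2r => <-.
apply: ler_sum => j _; apply: (bigmax_sup (g j)) => //.
rewrite le_eqVlt; apply/orP; left; apply/eqP; apply: eq_big_nat => t /andP[t1 t2].
by rewrite (window_batch WT bE t1 t2) /mu /batch_means /= (window_batch WT bE t1 t2) eqxx.
Qed.

Lemma batch_size_window T W (b : nat -> 'I_(size W)) i :
  sumn W = T ->
  (forall t, (t < T)%N -> val (b t) = reshape_index W t) ->
  batch_size T b i = nth 0%N W i.
Proof.
move=> WT bE; rewrite /batch_size.
have := sum_windows W (fun t => (b t == i) : nat); rewrite WT => <-.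
have wE (j : 'I_(size W)) : (\sum_(wstart W j <= t < wstart W j + nth 0 W j) (b t == i) =
    nth 0 W j * (j == i))%N.
  rewrite (eq_big_nat _ _ (F2 := fun=> (j == i) : nat)) => [|t /andP[t1 t2]].
    by rewrite sum_nat_const_nat addKn.
  by rewrite (window_batch WT bE t1 t2).
rewrite (bigD1 i) //= wE eqxx muln1 big1 ?addr0 // => j /negPf ji.
by rewrite wE ji muln0.
Qed.

(* [b] is monotone with values below [size W], so it jumps at most
   [(size W).-1] times. *)
Lemma variation_batches (R : realType) K T W (b : nat -> 'I_(size W))
    (eps : 'I_(size W) -> R) (g : 'I_(size W) -> option 'I_K) (e : R) :
  (forall i, 0 <= eps i <= e) ->
  (forall t, (t < T)%N -> val (b t) = reshape_index W t) ->
  \sum_(t < T.-1) \big[Num.max/0]_(k < K)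
    `|batch_means b eps g t k - batch_means b eps g t.+1 k|
  <= (size W).-1%:R * e.
Proof.
move=> epse bE.
have e0 : 0 <= e by have /andP[/le_trans h /h] := epse (b 0%N).
apply: (@le_trans _ _ (\sum_(t < T.-1) ((b t.+1)%:R - (b t)%:R) * e)).
  apply: ler_sum => t _.
  have tT : (t.+1 < T)%N by have := ltn_ord t; lia.
  have [/val_inj bt|bt] := eqVneq (val (b t)) (val (b t.+1)).
    rewrite bt subrr mul0r; apply: bigmax_le => // k _.
    by rewrite /batch_means bt subrr normr0.
  have bb : (b t < b t.+1)%N.
    rewrite ltn_neqAle bt /=; have := leqnSn t.
    rewrite (reshape_leq W) -!bE //; last by apply: ltnW.
    by rewrite /= => /orP[/ltnW //|/andP[/eqP -> _]].
  apply: (@le_trans _ _ e).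
    apply: bigmax_le => // k _; rewrite /batch_means.
    have := epse (b t); have := epse (b t.+1) => /andP[? ?] /andP[? ?].
    by rewrite ler_norml; case: ifP => _; case: ifP => _; apply/andP; split; lra.
  by rewrite -[leLHS]mul1r ler_wpM2r // lerBrDl natr1 ler_nat.
rewrite -mulr_suml ler_wpM2r //.
rewrite -(big_mkord xpredT (fun t => (b t.+1)%:R - (b t)%:R)).
rewrite (telescope_sumr (fun t => (b t)%:R : R)) // lerBlDr -natrD ler_nat.
by have := ltn_ord (b T.-1); lia.
Qed.

Lemma minimax_regret_batches (R : realType) K T (W : seq nat) (Ws : seq (seq nat))
    (V e : R) (pol : policy R K) :
  let D := [seq sumn U | U <- Ws] in
  valid_policy pol -> (2 <= K)%N -> (0 < T)%N -> flatten Ws = W -> sumn W = T ->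
  (forall d, d \in D -> K <= d)%N ->
  (forall d, d \in D -> Num.sqrt (K%:R / d%:R) / 4 <= e) ->
  (size D).-1%:R * e <= V ->
  bandit_c R * \sum_(d <- D) Num.sqrt (K%:R * d%:R) <= minimax_regret T W V pol.
Proof.
move=> D vp K2 T0 WsW WT KD De DV.
have DT : sumn D = T by rewrite -WT -WsW sumn_flatten.
have D0 : (0 < size D)%N by case: D DT T0 {KD De DV} => //= <-.
(* Batch 0 is a default for indices out of range, which do not occur when [t < T]. *)
pose b t : 'I_(size D) := insubd (Ordinal D0) (reshape_index D t).
have bE t : (t < T)%N -> val (b t) = reshape_index D t.
  by move=> tT; rewrite val_insubd reshape_indexP // DT.
have sE i : batch_size T b i = nth 0%N D i by apply: batch_size_window.
pose eps (i : 'I_(size D)) : R := Num.sqrt (K%:R / (batch_size T b i)%:R) / 4.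
have KDi i : (K <= batch_size T b i)%N by rewrite sE KD ?mem_nth.
have [g Hg] := exists_good_arms vp K2 KDi (fun i => erefl (eps i)).
have epse i : 0 <= eps i <= e.
  by rewrite divr_ge0 ?sqrtr_ge0 //= /eps sE De ?mem_nth.
have eps4 i : 0 <= eps i <= 1 / 4.
  rewrite divr_ge0 ?sqrtr_ge0 //= ler_pM2r // -[leRHS]sqrtr1 ler_sqrt //.
  by rewrite ler_pdivrMr ?mul1r ?ler_nat // ltr0n (leq_trans _ (KDi i)) // ltnW.
have -> : \sum_(d <- D) Num.sqrt (K%:R * d%:R) =
    \sum_i Num.sqrt (K%:R * (batch_size T b i)%:R) :> R.
  by rewrite (big_nth 0%N) big_mkord; apply: eq_bigr => i _; rewrite sE.
apply: (le_trans Hg).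
apply: (le_trans (regret_batches g vp DT (fun i => (andP (epse i)).1) bE)).
rewrite -WsW; apply: (le_trans (regret_flatten T Ws pol _)).
rewrite WsW; apply: regret_le_minimax => //; split.
  by move=> t k; have /andP[? ?] := batch_means_bounds b (Some \o g) t k eps4; rewrite !ltW.
by apply: le_trans DV; apply: variation_batches.
Qed.

(** * Grouping the windows *)

Lemma bandit_c_ge0 (R : realType) : 0 <= bandit_c R.
Proof.
have /andP[l0 l1] := ln43_bounds R.
have : Num.sqrt (ln (4 / 3 : R)) <= 1.
  by rewrite -[leRHS]sqrtr1 ler_sqrt //; lra.
by rewrite /bandit_c; lra.
Qed.

(** Apart from their signs, the fractional powers enter the computations only through their
    cubes. *)
Lemma powR13_cube (R : realType) (x : R) : 0 <= x -> (x `^ (1 / 3)) ^+ 3 = x.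
Proof.
move=> x0; rewrite -powR_mulrn ?powR_ge0 // -powRrM.
by rewrite (_ : 1 / 3 * 3%:R = 1) ?powRr1 //; field.
Qed.

Lemma powR23_cube (R : realType) (x : R) : 0 <= x -> (x `^ (2 / 3)) ^+ 3 = x ^+ 2.
Proof.
move=> x0; rewrite -powR_mulrn ?powR_ge0 // -powRrM.
by rewrite (_ : 2 / 3 * 3%:R = 2%:R) ?powR_mulrn //; field.
Qed.

Lemma size_mulr_le_sumn (R : realType) (B : R) (D : seq nat) :
  (forall d, d \in D -> B <= d%:R) -> (size D)%:R * B <= (sumn D)%:R.
Proof.
elim: D => [|d D IH] BD /=; first by rewrite mul0r.
rewrite natrD -natr1 mulrDl mul1r addrC lerD ?BD ?mem_head //.
by apply: IH => x xD; rewrite BD // inE xD orbT.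
Qed.

(** Greedy grouping from the right: [G] is the open group at the front. Adding [w <= B] keeps it
    below [B] or closes it with a sum of at most [2 * B]. *)
Lemma group_windows (R : realType) (B : R) (W : seq nat) :
  0 < B -> (forall w, w \in W -> w%:R <= B) ->
  exists G Gs, [/\ W = G ++ flatten Gs, (sumn G)%:R < B &
    forall U, U \in Gs -> B <= (sumn U)%:R <= 2 * B].
Proof.
move=> B0; elim: W => [|w W IH] WB; first by exists [::], [::].
have [|G [Gs [-> GB GsB]]] := IH; first by move=> x xW; rewrite WB // inE xW orbT.
have wB : w%:R <= B by rewrite WB ?mem_head.
have [lt|ge] := ltP ((sumn (w :: G))%:R) B; first by exists (w :: G), Gs.
exists [::], ((w :: G) :: Gs); split=> // U; rewrite inE => /orP[/eqP ->|]; last exact: GsB.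
by rewrite ge /= natrD; lra.
Qed.

(** The leftover group, shorter than [B], joins the first closed one, of length at most [2 * B].
    Without a closed group it is all of [W]. *)
Lemma group_windows_all (R : realType) (B : R) (W : seq nat) :
  0 < B -> (forall w, w \in W -> w%:R <= B) ->
  exists Ws, [/\ flatten Ws = W,
    forall U, U \in Ws -> (sumn U)%:R <= 3 * B &
    Ws = [:: W] \/ forall U, U \in Ws -> B <= (sumn U)%:R].
Proof.
move=> B0 WB; have [G [[|U0 Gs] [-> GB GsB]]] := group_windows B0 WB.
  exists [:: G]; rewrite /= cats0; split=> //; last by left.
  by move=> U; rewrite inE => /eqP ->; lra.
have /andP[U1 U2] := GsB _ (mem_head _ _).
have GsB' U : U \in Gs -> B <= (sumn U)%:R <= 2 * B.
  by move=> UGs; apply: GsB; rewrite inE UGs orbT.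
exists ((G ++ U0) :: Gs); split=> /=; first by rewrite catA.
  move=> U; rewrite inE => /orP[/eqP ->|/GsB' /andP[_ h]]; last by lra.
  by rewrite sumn_cat natrD; lra.
right=> U; rewrite inE => /orP[/eqP ->|/GsB' /andP[]] //.
by rewrite sumn_cat natrD; have := ler0n R (sumn G); lra.
Qed.

(* With the critical length [B = K ^ (1/3) * (T / V) ^ (2/3)], there are at most
   [T / B] batches and each change costs at most [sqrt (K / B) / 4], for a total
   variation of at most [V / 4]. *)
Lemma minimax_regret_groups (R : realType) K T (W : seq nat) (Ws : seq (seq nat))
    (V B : R) (pol : policy R K) :
  valid_policy pol -> (2 <= K)%N -> (K <= T)%N -> flatten Ws = W -> sumn W = T ->
  0 < V -> V <= T%:R / K%:R -> 0 < B -> B ^+ 3 = K%:R * (T%:R / V) ^+ 2 ->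
  Ws = [:: W] \/ (forall U, U \in Ws -> B <= (sumn U)%:R) ->
  bandit_c R * \sum_(U <- Ws) Num.sqrt (K%:R * (sumn U)%:R)
    <= minimax_regret T W V pol.
Proof.
move=> vp K2 KT WsW WT V0 VT B0 B3 cases.
have K0 : 0 < K%:R :> R by rewrite ltr0n; lia.
have T0 : 0 < T%:R :> R by rewrite ltr0n; lia.
have [b0 v0] := (ltW B0, ltW V0).
rewrite -(big_map sumn xpredT (fun d : nat => Num.sqrt (K%:R * d%:R))).
case: cases => [WsE|BWs].
  (* A single batch has no jump: [(size D).-1 = 0]. *)
  apply: (minimax_regret_batches (e := Num.sqrt (K%:R / T%:R) / 4)) => //; first by lia.
  - by move=> d; rewrite WsE /= WT inE => /eqP ->.
  - by move=> d; rewrite WsE /= WT inE => /eqP ->.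
  - by rewrite WsE mul0r ltW.
set D := map _ _.
have BD d : d \in D -> B <= d%:R by case/mapP => U /BWs + ->.
(* [V <= T / K] gives [T / V >= K], hence [B ^+ 3 >= K ^+ 3]; every batch then has length at least
   [K]. *)
have KB : K%:R <= B.
  rewrite -(@ler_pXn2r _ 3) ?nnegrE // B3 [_ ^+ 3]exprS ler_pM2l //.
  rewrite ler_pXn2r ?nnegrE ?divr_ge0 //.
  by rewrite ler_pdivlMr // mulrC -ler_pdivlMr.
apply: (minimax_regret_batches (e := Num.sqrt (K%:R / B) / 4)) => //; first by lia.
- by move=> d /BD Bd; rewrite -(ler_nat R) (le_trans KB).
- move=> d /BD Bd; rewrite ler_pM2r // ler_sqrt ?divr_ge0 //.
  by rewrite ler_pM2l // lef_pV2 ?posrE ?(lt_le_trans B0).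
have DT : sumn D = T by rewrite -WT -WsW sumn_flatten.
have nD : (size D)%:R * B <= T%:R by rewrite -DT; exact: size_mulr_le_sumn.
have n1 : (size D).-1%:R <= T%:R / B.
  rewrite ler_pdivlMr // (le_trans _ nD) // ler_pM2r // ler_nat; lia.
have E : Num.sqrt (K%:R / B) = V * B / T%:R.
  have y0 : 0 <= V * B / T%:R by rewrite divr_ge0 ?mulr_ge0.
  rewrite -[RHS]ger0_norm // -sqrtr_sqr; congr Num.sqrt.
  rewrite (_ : K%:R = B ^+ 3 * (V / T%:R) ^+ 2); last by rewrite B3; field; rewrite !gt_eqF.
  by field; rewrite !gt_eqF.
rewrite E; apply: (@le_trans _ _ (T%:R / B * (V * B / T%:R / 4))).
  by rewrite ler_wpM2r // divr_ge0 // divr_ge0 ?mulr_ge0.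
rewrite (_ : T%:R / B * (V * B / T%:R / 4) = V / 4); first by lra.
by field; rewrite !gt_eqF.
Qed.

Theorem theorem2 (R : realType) (K T : nat) (V : R) (W : seq nat)
  (pol : policy R K) :
  (2 <= K)%N -> (K <= T)%N -> 0 < V -> V <= T%:R / K%:R ->
  (forall w, w \in W -> (0 < w)%N) -> sumn W = T ->
  valid_policy pol ->
  ((forall w, w \in W -> w%:R <= K%:R `^ (1/3) * (T%:R / V) `^ (2/3)) ->
     bandit_c R / 3 * (K%:R * V) `^ (1/3) * T%:R `^ (2/3)
       <= minimax_regret T W V pol) /\
  ((forall w, w \in W -> K%:R `^ (1/3) * (T%:R / V) `^ (2/3) <= w%:R) ->
     bandit_c R * \sum_(w <- W) Num.sqrt (K%:R * w%:R)
       <= minimax_regret T W V pol).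
Proof.
move=> K2 KT V0 VT _ WT vp.
have K0 : 0 < K%:R :> R by rewrite ltr0n; lia.
have T0 : 0 < T%:R :> R by rewrite ltr0n; lia.
set B := K%:R `^ (1/3) * (T%:R / V) `^ (2/3).
have v0 := ltW V0.
have B0 : 0 < B by rewrite mulr_gt0 // powR_gt0 // divr_gt0.
have B3 : B ^+ 3 = K%:R * (T%:R / V) ^+ 2.
  by rewrite exprMn powR13_cube ?powR23_cube ?divr_ge0.
have b0 := ltW B0.
split=> HW; last first.
  (* In (ii) each window is a group by itself. *)
  pose Ws := [seq [:: w] | w <- W].
  have WsW : flatten Ws = W by exact: flatten_seq1.
  have := minimax_regret_groups vp K2 KT WsW WT V0 VT B0 B3; rewrite big_map /=.
  under eq_bigr do rewrite addn0.
  by apply; right=> _ /mapP[w wW ->]; rewrite /= addn0 HW.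
have [Ws [WsW Ws3 cases]] := group_windows_all B0 HW.
apply: le_trans (minimax_regret_groups vp K2 KT WsW WT V0 VT B0 B3 cases).
rewrite -2!mulrA ler_wpM2l ?bandit_c_ge0 //.
set X := _ `^ _ * _ `^ _.
have X0 : 0 <= X by rewrite mulr_ge0 ?powR_ge0.
(* Checked on cubes: both sides become [K ^+ 3 * T ^+ 6]. *)
have X2 : X ^+ 2 * B = T%:R ^+ 2 * K%:R.
  apply: (@pexpIrn _ 3) => //; first by rewrite nnegrE mulr_ge0 // sqr_ge0.
    by rewrite nnegrE mulr_ge0 // sqr_ge0.
  rewrite /= exprMn B3 exprAC [X ^+ 3](_ : _ = K%:R * V * T%:R ^+ 2); last first.
    by rewrite /X exprMn powR13_cube ?powR23_cube ?mulr_ge0.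
  by field; rewrite gt_eqF.
(* The target [X / 3] is shared among the groups in proportion to their lengths, which reduces the
   claim to one group. *)
have -> : 3^-1 * X = \sum_(U <- Ws) (sumn U)%:R * (X / (3 * T%:R)).
  rewrite -mulr_suml -natr_sum.
  have -> : (\sum_(U <- Ws) sumn U)%N = T.
    by rewrite -WT -WsW sumn_flatten sumnE big_map.
  by field; rewrite gt_eqF.
rewrite !big_seq; apply: ler_sum => U UWs.
have U0 : 0 <= (sumn U)%:R :> R by [].
have U3 := Ws3 U UWs.
have y0 : 0 <= (sumn U)%:R * (X / (3 * T%:R)).
  by rewrite mulr_ge0 // divr_ge0 // mulr_ge0.
rewrite -[leLHS]ger0_norm // -sqrtr_sqr ler_sqrt ?mulr_ge0 //.
(* The last factor is at most 1 because [sumn U <= 3 * B]. *)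
have -> : ((sumn U)%:R * (X / (3 * T%:R))) ^+ 2
   = K%:R * (sumn U)%:R * ((sumn U)%:R / (9 * B)).
  have -> : K%:R = X ^+ 2 * B / T%:R ^+ 2 by rewrite X2; field; rewrite gt_eqF.
  by field; rewrite !gt_eqF.
rewrite ler_piMr ?mulr_ge0 // ler_pdivrMr; last by rewrite mulr_gt0.
by lra.
Qed.
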